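(* Let $X$ be a metric space. If $\operatorname{coasdim}(X)\le fin+k$ for some $k\in\mathbb{N}$ with $k\ge1$, then $\operatorname{trasdim}(X)\le\omega+k-1$. In particular, $\operatorname{coasdim}(X)=fin+1$ implies $\operatorname{trasdim}(X)=\omega$.
   Context: For subsets $U,V$ of a metric space $(X,d)$, $\operatorname{diam}U=\sup\{d(x,y):x,y\in U\}$ and $d(U,V)=\inf\{d(x,y):x\in U,y\in V\}$. A family $\mathcal{U}$ of subsets is $R$-bounded if $\operatorname{diam}U\le R$ for all $U\in\mathcal{U}$, uniformly bounded if it is $R$-bounded for some $R>0$, and $r$-disjoint if $d(U,V)\ge r$ for all $U\ne V$ in $\mathcal{U}$. $\bigcup\mathcal{U}$ denotes the union of the members of $\mathcal{U}$. $\operatorname{asdim}X\le n$ means: for every $r>0$ there are uniformly bounded, $r$-disjoint families $\mathcal{U}_0,\dots,\mathcal{U}_n$ of subsets of $X$ such that $\bigcup_{i=0}^n\mathcal{U}_i$ covers $X$. $\operatorname{asdim}X=\infty$ if $\operatorname{asdim}X\le n$ holds for no $n$. $\operatorname{coasdim}(X)\le fin+k$ means that for every $n\in\mathbb{N}$ there exist $R>0$, $m\in\mathbb{N}$ and $n$-disjoint, $R$-bounded families $\mathcal{U}_1,\dots,\mathcal{U}_k$ of subsets of $X$ such that $\operatorname{asdim}\big(X\setminus\bigcup(\bigcup_{i=1}^k\mathcal{U}_i)\big)\le m$. $\operatorname{coasdim}(X)=fin+1$ means $\operatorname{coasdim}(X)\le fin+1$ and $\operatorname{asdim}(X)=\infty$.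 Transfinite asymptotic dimension: let $Fin\,\mathbb{N}$ be the collection of finite nonempty subsets of $\mathbb{N}$. For $M\subseteq Fin\,\mathbb{N}$ and $a\in\mathbb{N}$ let $M^a=\{\tau\in Fin\,\mathbb{N}:\tau\cup\{a\}\in M,\ a\notin\tau\}$. Define inductively: $\operatorname{Ord}M=0$ iff $M=\varnothing$; $\operatorname{Ord}M\le\alpha$ iff $\operatorname{Ord}M^a<\alpha$ for all $a\in\mathbb{N}$ (for ordinals $\alpha>0$); $\operatorname{Ord}M=\alpha$ iff $\operatorname{Ord}M\le\alpha$ and not $\operatorname{Ord}M<\alpha$; $\operatorname{Ord}M=\infty$ iff $\operatorname{Ord}M\le\alpha$ for no ordinal $\alpha$. Let $A(X,d)$ be the set of all $\sigma\in Fin\,\mathbb{N}$ such that there are no uniformly bounded families $\mathcal{U}_i$ $(i\in\sigma)$ with each $\mathcal{U}_i$ $i$-disjoint and $\bigcup_{i\in\sigma}\mathcal{U}_i$ covering $X$. Then $\operatorname{trasdim}X=\operatorname{Ord}A(X,d)$. *)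

(* Defs.v *)
From mathcomp Require Import all_boot all_order all_algebra.
From mathcomp Require Import finmap.
From mathcomp Require Import all_classical all_reals all_analysis.

Set Implicit Arguments.
Unset Strict Implicit.
Unset Printing Implicit Defensive.

Import Order.TTheory GRing.Theory Num.Theory.
Local Open Scope classical_set_scope.
Local Open Scope ring_scope.

Section AsymptoticDimension.
Context {R : realType} {X : metricType R}.
Implicit Types (U V S : set X) (F : set (set X)).

(* With the conventions of ereal_sup and ereal_inf, diam set0 = -oo and
   setdist set0 V = +oo.  Both values are only compared with real numbers, with
   diam only against positive ones, so the convention diam set0 = 0 would give
   the same notions below. *)
Definition diam U : \bar R :=
  ereal_sup [set (mdist x y)%:E | x in U & y in U].

Definition setdist U V : \bar R :=
  ereal_inf [set (mdist x y)%:E | x in U & y in V].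

Definition bounded_family (B : R) F :=
  forall U, F U -> (diam U <= B%:E)%E.

Definition uniformly_bounded F := exists2 B : R, 0 < B & bounded_family B F.

Definition disjoint_family (r : R) F :=
  forall U V, F U -> F V -> U <> V -> (r%:E <= setdist U V)%E.

(* asdim S <= n, where S carries the restricted metric: the families consist of
   subsets of S. *)
Definition asdim_le S (n : nat) :=
  forall r : R, 0 < r -> exists F : 'I_n.+1 -> set (set X),
    [/\ forall i U, F i U -> U `<=` S,
        forall i, uniformly_bounded (F i) /\ disjoint_family r (F i)
      & S `<=` \bigcup_(i in [set: 'I_n.+1]) \bigcup_(U in F i) U].

Definition asdim_infty S := forall n : nat, ~ asdim_le S n.

End AsymptoticDimension.

(* coasdim X <= fin + k *)
Definition coasdim_le_fin {R : realType} (X : metricType R) (k : nat) :=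
  forall n : nat, exists (B : R) (m : nat) (F : 'I_k -> set (set X)),
    [/\ 0 < B,
        forall i, disjoint_family n%:R (F i) /\ bounded_family B (F i)
      & asdim_le ([set: X] `\`
          \bigcup_(i in [set: 'I_k]) \bigcup_(U in F i) U) m].

(* coasdim X = fin + 1 *)
Definition coasdim_eq_fin1 {R : realType} (X : metricType R) :=
  coasdim_le_fin X 1 /\ asdim_infty [set: X].

(* Set-theoretic ordinals as well-founded trees: olim f is the least ordinal
   strictly above all the f i.  Different trees may denote the same ordinal, and
   equality of ordinals is oeq. *)
Inductive onum : Type := olim (I : Type) (f : I -> onum).

Fixpoint ole (a b : onum) {struct a} : Prop :=
  let: olim T f := a in let: olim J g := b in
  forall i : T, exists j : J, ole (f i) (g j).

Definition olt (a b : onum) : Prop :=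
  let: olim J g := b in exists j : J, ole a (g j).

Definition oeq (a b : onum) : Prop := ole a b /\ ole b a.

Definition ozero : onum := olim (fun e : Empty_set => match e with end).

Definition osucc (a : onum) : onum := olim (fun _ : unit => a).

Fixpoint onat (n : nat) : onum := if n is n'.+1 then osucc (onat n') else ozero.

Definition omega : onum := olim onat.

(* a + b is the least ordinal above every c < a and every a + d with d < b. *)
Fixpoint oadd (a b : onum) {struct b} : onum :=
  let: olim T f := a in let: olim J g := b in
  olim (fun s : T + J =>
    match s with inl i => f i | inr j => oadd a (g j) end).

Definition FinN : set {fset nat} := [set s | s != fset0].

(* M^a *)
Definition residual (M : set {fset nat}) (a : nat) : set {fset nat} :=
  [set t | [/\ FinN t, M (t `|` [fset a])%fset & a \notin t]].

(* Ord M <= alpha.  The inner exists2 says Ord (M^a) < alpha.  Lemmas Ord_le0P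
   and Ord_leP below are the two defining clauses. *)
Inductive Ord_le (M : set {fset nat}) (alpha : onum) : Prop :=
| Ord_le_zero of oeq alpha ozero & M = set0
| Ord_le_pos of olt ozero alpha &
    (forall a : nat,
       exists2 beta, olt beta alpha & Ord_le (residual M a) beta).

Definition Ord_lt (M : set {fset nat}) (alpha : onum) :=
  exists2 beta, olt beta alpha & Ord_le M beta.

Definition Ord_eq (M : set {fset nat}) (alpha : onum) :=
  Ord_le M alpha /\ ~ Ord_lt M alpha.

Lemma oeq0_nlt alpha : oeq alpha ozero -> ~ olt ozero alpha.
Proof. by case: alpha => J g [+ _] [j _] => /(_ j) []; case. Qed.

Lemma Ord_le0P M alpha : oeq alpha ozero -> Ord_le M alpha <-> M = set0.
Proof.
move=> a0; split=> [[//|/(oeq0_nlt a0)//]|M0].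
exact: Ord_le_zero.
Qed.

Lemma Ord_leP M alpha : olt ozero alpha ->
  Ord_le M alpha <-> forall a : nat, Ord_lt (residual M a) alpha.
Proof.
move=> a0; split=> [[/oeq0_nlt /(_ a0)//|_ h]|h]; first exact: h.
exact: Ord_le_pos.
Qed.

Section TransfiniteDimension.
Context {R : realType} (X : metricType R).

(* A(X, d) *)
Definition asdim_obstruction : set {fset nat} :=
  [set s | FinN s /\ ~ exists F : nat -> set (set X),
     (forall i, i \in s ->
        uniformly_bounded (F i) /\ disjoint_family i%:R (F i)) /\
     [set: X] `<=` \bigcup_(i in [set i | i \in s]) \bigcup_(U in F i) U].

Definition trasdim_le (alpha : onum) := Ord_le asdim_obstruction alpha.

Definition trasdim_eq (alpha : onum) := Ord_eq asdim_obstruction alpha.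

End TransfiniteDimension.

(* Main.v *)
Require Import Defs.
From mathcomp Require Import all_boot all_order all_algebra.
From mathcomp Require Import finmap.
From mathcomp Require Import all_classical all_reals all_analysis.

(** Given distinct a_1, ..., a_k, apply the coasdim hypothesis with n = max a_i:
the resulting k families serve the indices a_i, and what they miss has
asymptotic dimension at most some m, so it is covered using any m + 1 further
indices.  Hence every element of A(X)^{a_1 ... a_k} has at most m elements, and
a set system whose members have bounded size has finite order; the first k
residuals account for the summand k - 1 and for the limit omega.  Conversely,
if Ord A(X) is at most a natural number n, no set of n + 1 indices belongs to
A(X), and sets of large indices show that asdim X <= n. *)

Set Implicit Arguments.
Unset Strict Implicit.
Unset Printing Implicit Defensive.

Import Order.TTheory GRing.Theory Num.Theory.

Lemma ole_refl a : ole a a.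
Proof. by elim: a => I f IH i; exists i; exact: IH. Qed.

Lemma ole_trans a b c : ole a b -> ole b c -> ole a c.
Proof.
elim: a b c => I f IH [J g] [K h] ab bc i.
have [j fg] := ab i; have [l gh] := bc j.
by exists l; apply: IH fg gh.
Qed.

Lemma olt_ole_trans a b c : olt a b -> ole b c -> olt a c.
Proof.
case: b c => J g [K h] [j ag] bc.
by have [l gh] := bc j; exists l; apply: ole_trans ag gh.
Qed.

Lemma ole0 a : ole ozero a.
Proof. by case: a => J g; case. Qed.

(** Each finite ordinal is a branch of [omega], and [oadd] keeps the branches of its left
    summand. *)
Lemma olt_omegaD_onat m n : olt (onat m) (oadd omega (onat n)).
Proof. by case: n => [|n]; exists (inl m); apply: ole_refl. Qed.

Lemma omegaD0_le : ole (oadd omega ozero) omega.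
Proof. by case=> [n|[]]; exists n; apply: ole_refl. Qed.

Lemma residual0 a : residual set0 a = set0.
Proof. by rewrite -subset0 => t []. Qed.

Lemma Ord_le_set0 alpha : Ord_le set0 alpha.
Proof.
have [a0|a0] := pselect (olt ozero alpha).
  apply: Ord_le_pos => // a; exists ozero => //; rewrite residual0.
  by apply: Ord_le_zero => //; split; apply: ole_refl.
(* A tree not above zero has no branches, hence denotes zero. *)
apply: Ord_le_zero => //; split; last exact: ole0.
case: alpha a0 => J g a0 j.
by exfalso; apply: a0; exists j; apply: ole0.
Qed.

Lemma Ord_le_trans M a b : Ord_le M a -> ole a b -> Ord_le M b.
Proof.
case=> [_ -> _|a0 h ab]; first exact: Ord_le_set0.
apply: Ord_le_pos => [|x]; first exact: olt_ole_trans a0 ab.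
by have [c ca Mc] := h x; exists c => //; apply: olt_ole_trans ca ab.
Qed.

(** A member of the residual at [a] gains [a] to become a member of [M], so the size bound drops by
    one; at bound 0, [FinN] leaves no members. *)
Lemma Ord_le_onat M m :
  (forall t, M t -> FinN t /\ #|` t| <= m) -> Ord_le M (onat m).
Proof.
elim: m M => [|m IH] M Mm.
  suff -> : M = set0 by apply: Ord_le_set0.
  rewrite -subset0 => t /Mm [/= t0].
  by rewrite leqn0 cardfs_eq0 (negPf t0).
apply: Ord_le_pos => [|a]; first by exists tt; apply: ole0.
exists (onat m); first by exists tt; apply: ole_refl.
apply: IH => t [t0 /Mm [_ tm] at_]; split=> //.
by rewrite fsetUC cardfsU1 at_ in tm.
Qed.

Lemma Ord_le_onat_card M m t : Ord_le M (onat m) -> M t -> #|` t| <= m.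
Proof.
elim: m M t => [|m IH] M t; case.
- by move=> _ ->.
- by case=> -[].
- by move=> _ ->.
move=> _ h Mt.
have [->|[a at_]] := fset_0Vmem t; first by rewrite cardfs0.
have [b [[] bm] Mb] := h a.
(* For a singleton [t], removing [a] leaves the empty set, which no residual contains; the bound is
   then immediate. *)
have [t1|t1] := eqVneq (t `\ a)%fset fset0.
  by rewrite (cardfsD1 a) at_ t1 cardfs0.
rewrite (cardfsD1 a) at_ ltnS; apply: IH (Ord_le_trans Mb bm) _.
by split=> //; rewrite 1?fsetUC ?fsetD1K // !inE eqxx.
Qed.

(** The first [k] residuals descend from [omega + k] to [omega]; the last may land at any finite
    ordinal, so [m] is free to depend on [s]. *)
Lemma Ord_le_omegaD M k :
  (forall s, size s = k.+1 ->
     exists m, forall t, foldl residual M s t -> #|` t| <= m) ->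
  Ord_le M (oadd omega (onat k)).
Proof.
elim: k M => [|k IH] M Ms; (apply: Ord_le_pos => [|a];
  first exact: (olt_omegaD_onat 0)).
  have [m mP] := Ms [:: a] erefl.
  exists (onat m); first exact: (olt_omegaD_onat m 0).
  by apply: Ord_le_onat => t Mt; split; [case: Mt|apply: mP].
exists (oadd omega (onat k)); first by exists (inr tt); apply: ole_refl.
by apply: IH => s sk; apply: (Ms (a :: s)); rewrite /= sk.
Qed.

(** Members of a residual at [a] avoid [a], so a repeated index would leave no members at all. *)
Lemma foldl_residual M s t : s != [::] -> foldl residual M s t ->
  [/\ uniq s, forall a, a \in s -> a \notin t & M (t `|` [fset a in s])%fset].
Proof.
elim: s M t => [//|a s IH] M t _ /=.
have [->/= [_ Mt at_]|s0 /(IH _ _ s0)[us st [_ Mt]]] := eqVneq s [::].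
  split=> // [b|]; first by rewrite inE => /eqP ->.
  by congr (M _) : Mt; apply/fsetP => b; rewrite !inE orbF.
rewrite !inE negb_or => /andP[at_ as_]; split.
- by rewrite as_.
- by move=> b; rewrite inE => /orP[/eqP ->//|/st].
- congr (M _) : Mt; apply/fsetP => b.
  by rewrite !inE -orbA; congr orb; rewrite orbC.
Qed.

Section Families.
Context {R : realType} {X : metricType R}.
Implicit Types F : set (set X).
Local Open Scope classical_set_scope.

Lemma disjoint_family_le (r r' : R) F :
  (r <= r')%R -> disjoint_family r' F -> disjoint_family r F.
Proof.
by move=> rr' h U V FU FV UV; apply: le_trans (h U V FU FV UV); rewrite lee_fin.
Qed.

Lemma uniformly_bounded0 : uniformly_bounded (set0 : set (set X)).
Proof. by exists 1%R. Qed.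

Lemma disjoint_family0 r : disjoint_family r (set0 : set (set X)).
Proof. by []. Qed.

Lemma leq_bigmax_id (s : seq nat) i : i \in s -> i <= \max_(j <- s) j.
Proof. by move=> si; apply: (@leq_bigmax_seq _ s xpredT id). Qed.

Lemma coasdim_obstruction_residual k (s : seq nat) :
  coasdim_le_fin X k.+1 -> size s = k.+1 ->
  exists m, forall t, foldl residual (asdim_obstruction X) s t -> #|` t| <= m.
Proof.
move=> Xk sk.
have [B [m [F [B0 FP Fm]]]] := Xk (\max_(j <- s) j).
exists m => t.
have s0 : s != [::] by rewrite -size_eq0 sk.
move=> /(foldl_residual s0)[us st [_ A]].
rewrite leqNgt; apply/negP => mt; apply: A.
(* The successor keeps the radius positive when the maximum is 0. *)
have [|G [_ GP Gcov]] := Fm (\max_(j <- t) j).+1%:R%R; first by rewrite ltr0n.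
(* Families are assigned by position: elements of [s] receive those of [F], the first [m + 1]
   elements of [t] those of [G], any others the empty family. *)
pose H i := if i \in s then F (inord (index i s)) else
  if index i t < m.+1 then G (inord (index i t)) else set0.
exists H; split=> [i|x _].
  rewrite !inE /H; have [is_|is_] := boolP (i \in s).
    move=> _; have [dF bF] := FP (inord (index i s)); split; first by exists B.
    by apply: disjoint_family_le dF; rewrite ler_nat leq_bigmax_id.
  rewrite orbF => it.
  case: ifP => _; last by split; [apply: uniformly_bounded0|apply: disjoint_family0].
  have [bG dG] := GP (inord (index i t)); split=> //.
  by apply: disjoint_family_le dG; rewrite ler_nat leqW // leq_bigmax_id.
have [[j _ [U FU Ux]]|xF] :=
  pselect ((\bigcup_(i in [set: 'I_k.+1]) \bigcup_(U in F i) U) x).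
  have js : nth 0 s j \in s by rewrite mem_nth // sk.
  exists (nth 0 s j); first by rewrite /= !inE js orbT.
  by exists U => //; rewrite /H js index_uniq ?sk // inord_val.
have [|j _ [U GU Ux]] := Gcov x; first by split.
(* Here [t] having more than [m] elements ensures that each family of [G] has an index. *)
have jt : j < size t by apply: leq_trans (ltn_ord j) mt.
have jt' : nth 0 t j \in t by rewrite mem_nth.
exists (nth 0 t j); first by rewrite /= !inE jt'.
exists U => //; rewrite /H ifN; last by apply/negP => /st; rewrite jt'.
by rewrite index_uniq ?fset_uniq // ltn_ord inord_val.
Qed.

Lemma trasdim_le_onat_asdim_le n :
  trasdim_le X (onat n) -> asdim_le [set: X] n.
Proof.
move=> Xn r r0.
(* All indices from [N] on are at least [r], so disjointness at any of them suffices. *)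
pose N := (Num.truncn r).+1.
have rN : (r <= N%:R)%R by apply/ltW/truncnS_gt.
pose s := [fset x in iota N n.+1]%fset.
have sN i : (i \in s) = (N <= i < N + n.+1) by rewrite in_fset mem_iota.
have cs : #|` s| = n.+1.
  by rewrite card_fseq undup_id ?iota_uniq // size_iota.
have : ~ asdim_obstruction X s.
  by move=> /(Ord_le_onat_card Xn); rewrite cs ltnn.
move=> /not_andP[|/contrapT[F [FP Fcov]]].
  by case; rewrite /FinN /= -cardfs_eq0 cs.
exists (fun j : 'I_n.+1 => F (N + j)); split=> [//|j|x xX].
  have [|bF dF] := FP (N + j).
    by rewrite sN leq_addr ltn_add2l ltn_ord.
  split=> //; apply: disjoint_family_le dF.
  by apply: le_trans rN _; rewrite ler_nat leq_addr.
have [i /= + [U FU Ux]] := Fcov x xX.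
rewrite sN => /andP[Ni iN].
have iNn : i - N < n.+1 by rewrite ltn_subLR.
by exists (Ordinal iNn) => //; exists U => //=; rewrite subnKC.
Qed.

End Families.

Theorem theorem3p2 (R : realType) (X : metricType R) :
  (forall k : nat, (1 <= k)%N -> coasdim_le_fin X k ->
     trasdim_le X (oadd omega (onat (k - 1)))) /\
  (coasdim_eq_fin1 X -> trasdim_eq X omega).
Proof.
have le_omegaD k : 1 <= k -> coasdim_le_fin X k ->
    trasdim_le X (oadd omega (onat (k - 1))).
  case: k => // k _ Xk; rewrite subn1.
  by apply: Ord_le_omegaD => s; apply: coasdim_obstruction_residual.
split=> // -[X1 Xinf]; split.
  (* The trees [oadd omega ozero] and [omega] differ but denote the same ordinal. *)
  exact: Ord_le_trans (le_omegaD 1 erefl X1) omegaD0_le.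
case=> b [n bn] Xb.
exact: Xinf (trasdim_le_onat_asdim_le (Ord_le_trans Xb bn)).
Qed.
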